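(* Let $R$ be a commutative noetherian local ring with a unique minimal prime ideal $\mathfrak{q}$. For a Serre subcategory $\mathcal{S}$ of $R\text{-}\mathrm{Mod}$ consider the following two forms of $\mathbb{M}[\mathcal{S}]$: (a) $\mathbb{M}[\mathcal{S}]=\{\mathfrak{q}\}\cup W$ for a specialization closed subset $W$ of $\mathrm{Spec}(R)$; (b) $\mathbb{M}[\mathcal{S}]=\{\mathfrak{q}\}\cup\{\mathfrak{p}\}$ for a prime ideal $\mathfrak{p}$ of $R$ with $\mathrm{ht}\,\mathfrak{p}=1$. (1) If $\dim R=2$, then for each Serre subcategory $\mathcal{S}$ of $R\text{-}\mathrm{Mod}$, $\mathbb{M}[\mathcal{S}]$ has one of the forms (a), (b). (2) Suppose that for each Serre subcategory $\mathcal{S}$ of $R\text{-}\mathrm{Mod}$, $\mathbb{M}[\mathcal{S}]$ has one of the forms (a), (b). Then $\dim R\leq 2$.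
   Context: All rings are commutative noetherian and all modules are unitary. $R\text{-}\mathrm{Mod}$ is the category of all $R$-modules; subcategories are full and closed under isomorphisms. A Serre subcategory of $R\text{-}\mathrm{Mod}$ is a (nonempty) subcategory closed under taking submodules, quotient modules and extensions. For an ideal $I$ of $R$ and an $R$-module $M$, $\Gamma_I(M)=\{x\in M \mid I^n x=0 \text{ for some } n\geq 1\}$ and $(0:_M I)=\{x\in M\mid Ix=0\}$. A Serre subcategory $\mathcal{S}$ satisfies the Melkersson condition $(C_I)$ if: for every $R$-module $M$, if $\Gamma_I(M)=M$ and $(0:_M I)\in\mathcal{S}$, then $M\in\mathcal{S}$. Put $\mathbb{M}[\mathcal{S}]=\{\mathfrak{p}\in\mathrm{Spec}(R)\mid \mathcal{S}\text{ satisfies }(C_{\mathfrak{p}})\}$. A subset $W\subseteq\mathrm{Spec}(R)$ is specialization closed if $\mathfrak{p}\in W$ and $\mathfrak{p}\subseteq\mathfrak{p}'\in\mathrm{Spec}(R)$ imply $\mathfrak{p}'\in W$ (the empty set is allowed). *)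

(* Defs.v *)
From HB Require Import structures.
From mathcomp Require Import all_boot all_order all_algebra.
From mathcomp Require Import boolp classical_sets.

Set Implicit Arguments.
Unset Strict Implicit.
Unset Printing Implicit Defensive.

Import GRing.Theory.

Local Open Scope classical_set_scope.
Local Open Scope ring_scope.

Section Rings.
Variable R : comNzRingType.

(* Ideals are boolean predicates, as in ring_quotient; with the classical
   axioms of boolp these are all the subsets of R.  Note that idealr_closed
   includes properness. *)

(* Ideals, the unit ideal included, are the submodules of R^o. *)
Definition noetherian : Prop :=
  forall I : {pred R^o}, submod_closed I ->
    exists s : seq R, forall x : R,
      x \in I <-> exists c : 'I_(size s) -> R, x = \sum_i c i * s`_i.

Definition maximal_ideal (m : {pred R}) : Prop :=
  idealr_closed m /\
  forall J : {pred R}, idealr_closed J -> {subset m <= J} -> J = m.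

Definition local_ring : Prop := exists! m : {pred R}, maximal_ideal m.

Definition Spec : set {pred R} :=
  [set p | idealr_closed p /\ prime_idealr_closed p].

Definition minimal_prime (q : {pred R}) : Prop :=
  Spec q /\ forall p, Spec p -> {subset p <= q} -> p = q.

Definition unique_minimal_prime (q : {pred R}) : Prop :=
  minimal_prime q /\ forall p, minimal_prime p -> p = q.

(* p_0 < p_1 < ... < p_n, a chain of length n *)
Definition prime_chain (n : nat) (c : 'I_n.+1 -> {pred R}) : Prop :=
  (forall i, Spec (c i)) /\
  forall i j : 'I_n.+1, (i < j)%N ->
    {subset c i <= c j} /\ ~ {subset c j <= c i}.

Definition height_eq (p : {pred R}) (n : nat) : Prop :=
  (exists c : 'I_n.+1 -> {pred R}, prime_chain c /\ c ord_max = p) /\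
  (forall k (c : 'I_k.+1 -> {pred R}),
     prime_chain c -> c ord_max = p -> (k <= n)%N).

Definition krull_dim_le (n : nat) : Prop :=
  forall k (c : 'I_k.+1 -> {pred R}), prime_chain c -> (k <= n)%N.

Definition krull_dim_eq (n : nat) : Prop :=
  (exists c : 'I_n.+1 -> {pred R}, prime_chain c) /\ krull_dim_le n.

Definition specialization_closed (W : set {pred R}) : Prop :=
  W `<=` Spec /\
  forall p p', W p -> Spec p' -> {subset p <= p'} -> W p'.

(* I^n, with finite sums of R-multiples of n-fold products of elements of I *)
Definition ideal_exp (I : {pred R}) (n : nat) : set R :=
  [set x | exists k (c : 'I_k -> R) (a : 'I_k -> 'I_n -> R),
     (forall i j, a i j \in I) /\ x = \sum_i c i * \prod_j a i j].

End Rings.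

Section Modules.
Variables (R : comNzRingType) (I : {pred R}) (M : lmodType R).

Definition Gamma : set M :=
  [set x | exists2 n, (0 < n)%N & forall a, ideal_exp I n a -> a *: x = 0].

Definition ann_pred : {pred M} :=
  fun x => `[< forall a, a \in I -> a *: x = 0 >].

Lemma ann_pred_closed : submod_closed ann_pred.
Proof.
split; first by apply/asboolP => a _; rewrite scaler0.
move=> b x y /asboolP hx /asboolP hy; apply/asboolP => a aI.
by rewrite scalerDr scalerA mulrC -scalerA hx // hy // scaler0 addr0.
Qed.

HB.instance Definition _ :=
  GRing.isSubmodClosed.Build R M ann_pred ann_pred_closed.

(* The submodule (0 :_M I), as a module in its own right. *)
Definition ann_mod : Type := {x : M | ann_pred x}.

HB.instance Definition _ := [isSub of ann_mod for @sval M ann_pred].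
HB.instance Definition _ := [Choice of ann_mod by <:].
HB.instance Definition _ := [SubChoice_isSubZmodule of ann_mod by <:].
HB.instance Definition _ := [SubZmodule_isSubLmodule of ann_mod by <:].

End Modules.

Arguments Gamma {R} I M.
Arguments ann_mod {R} I M.

(* Closure under injections gives closure under submodules and under
   isomorphisms. *)
Record serre_subcategory (R : comNzRingType) (S : lmodType R -> Prop)
    : Prop := SerreSubcategory {
  serre_nonempty : exists M : lmodType R, S M;
  serre_sub : forall (L M : lmodType R) (f : {linear L -> M}),
    injective f -> S M -> S L;
  serre_quo : forall (M N : lmodType R) (g : {linear M -> N}),
    range g = setT -> S M -> S N;
  serre_ext : forall (L M N : lmodType R)
      (f : {linear L -> M}) (g : {linear M -> N}),
    injective f -> range f = [set x | g x = 0] -> range g = setT ->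
    S L -> S N -> S M }.

Definition melkersson (R : comNzRingType) (S : lmodType R -> Prop)
    (I : {pred R}) : Prop :=
  forall M : lmodType R, Gamma I M = setT -> S (ann_mod I M) -> S M.

Definition melkersson_locus (R : comNzRingType) (S : lmodType R -> Prop)
    : set {pred R} :=
  [set p | Spec p /\ melkersson S p].

Definition locus_form_a (R : comNzRingType) (q : {pred R})
    (S : lmodType R -> Prop) : Prop :=
  exists W : set {pred R},
    specialization_closed W /\ melkersson_locus S = [set q] `|` W.

Definition locus_form_b (R : comNzRingType) (q : {pred R})
    (S : lmodType R -> Prop) : Prop :=
  exists p : {pred R},
    [/\ Spec p, height_eq p 1 & melkersson_locus S = [set q] `|` [set p]].

(* Main.v *)
Require Import Defs.
From mathcomp Require Import all_boot all_order all_algebra.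
From mathcomp Require Import boolp classical_sets.
From HB Require Import structures.

Set Implicit Arguments.
Unset Strict Implicit.
Unset Printing Implicit Defensive.

Import GRing.Theory.

Local Open Scope classical_set_scope.
Local Open Scope ring_scope.

(** For the first claim, Krull dimension at most 2 leaves only q, the primes of
    height one and the maximal ideal m. The ideal q is nilpotent, which gives
    (C_q). The ideal p + p' generated by two distinct primes of height one has
    radical m, and (C_p) and (C_p') together give (C_m). So if m is not in the
    locus, at most one prime of height one is.

    For the second claim, suppose c0 < c1 < c2 < c3 are primes and choose P
    maximal among the primes containing c2 and different from m. Let S be the
    class of artinian modules M such that some s outside P kills (0 :_M P).
    A dual Artin-Rees argument shows that S is closed under quotients.
    Melkersson's criterion (M is artinian when it is p-torsion and (0 :_M p) is
    artinian) gives (C_p) for all p contained in P, in particular for c1 and c2.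
    But (C_m) fails for the module D[1/s]/D, where D = R/P is one-dimensional
    and s is in m but not in P: it is m-torsion with finitely generated socle,
    and no t outside P kills it, by Krull's intersection theorem. *)

(** * Extremal elements and monotone chains *)

Lemma extremal_exists (T : Type) (P : T -> Prop) (r : T -> T -> Prop) :
  (exists x, P x) ->
  (forall u : nat -> T, (forall n, P (u n)) -> (forall n, r (u n) (u n.+1)) ->
     exists n, r (u n.+1) (u n)) ->
  exists x, P x /\ forall y, P y -> r x y -> r y x.
Proof.
move=> [x0 Px0] stab; apply: contrapT => noext.
(* Without an extremal element, strict [r]-steps could be iterated by dependent choice, against the
   stabilization of chains. *)
have next (x : {x | P x}) : {y : {y | P y} | r (sval x) (sval y) /\ ~ r (sval y) (sval x)}.
  apply: cid; case: x => x Px /=; apply: contrapT => Nx; apply: noext.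
  exists x; split=> // y Py rxy; apply: contrapT => nryx.
  by apply: Nx; exists (exist _ y Py).
have [f [_ fr]] := dependent_choice next (exist _ x0 Px0).
have [n] := stab (sval \o f) (fun n => svalP (f n)) (fun n => (fr n).1).
exact: (fr n).2.
Qed.

Lemma monotone_chain (T : Type) (F : nat -> set T) :
  (forall n, F n `<=` F n.+1) -> forall i j, (i <= j)%N -> F i `<=` F j.
Proof.
move=> incF i j; elim: j => [|j IH]; first by rewrite leqn0 => /eqP ->.
by rewrite leq_eqVlt => /predU1P[-> //|/IH h]; apply: subset_trans (incF j).
Qed.

Lemma antitone_chain (T : Type) (F : nat -> set T) :
  (forall n, F n.+1 `<=` F n) -> forall i j, (i <= j)%N -> F j `<=` F i.
Proof.
move=> decF i j; elim: j => [|j IH]; first by rewrite leqn0 => /eqP ->.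
by rewrite leq_eqVlt => /predU1P[-> //|/IH h]; apply: subset_trans h.
Qed.

(** * Submodules as subsets of a fixed module *)

Section Submodules.
Variables (R : comNzRingType) (M : lmodType R).
Implicit Types (K L : set M).

Definition submod K : Prop :=
  K 0 /\ forall a x y, K x -> K y -> K (a *: x + y).

Lemma submod0 K : submod K -> K 0. Proof. by case. Qed.

Lemma submodD K x y : submod K -> K x -> K y -> K (x + y).
Proof. by move=> [_ hK] Kx Ky; rewrite -[x]scale1r; apply: hK. Qed.

Lemma submodZ K a x : submod K -> K x -> K (a *: x).
Proof. by move=> [K0 hK] Kx; rewrite -[_ *: _]addr0; apply: hK. Qed.

Lemma submodB K x y : submod K -> K x -> K y -> K (x - y).
Proof. by move=> sK Kx Ky; rewrite -scaleN1r; apply: submodD => //; apply: submodZ. Qed.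

Lemma submodT : submod [set: M]. Proof. by []. Qed.

Lemma submodI K L : submod K -> submod L -> submod (K `&` L).
Proof.
by move=> [K0 hK] [L0 hL]; split=> // a x y [Kx Lx] [Ky Ly]; split; [apply: hK|apply: hL].
Qed.

Lemma submod_bigcup (F : nat -> set M) :
  (forall n, submod (F n)) -> (forall n, F n `<=` F n.+1) ->
  submod (\bigcup_n F n).
Proof.
move=> sF incF.
have monF := monotone_chain incF.
split; first by exists 0%N => //; apply: submod0.
move=> a x y [i _ Fx] [j _ Fy]; exists (maxn i j) => //.
by apply: (sF _).2; [apply: monF Fx; rewrite leq_maxl|apply: monF Fy; rewrite leq_maxr].
Qed.

Lemma submod_scaler_ker (a : R) : submod [set x : M | a *: x = 0].
Proof.
split=> [|b x y /= ax ay]; rewrite /= ?scaler0 //.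
by rewrite scalerDr scalerA mulrC -scalerA ax ay scaler0 addr0.
Qed.

(** [A] ranges over ideals, finite lists of generators and sets of products alike. *)
Definition ann (A : R -> Prop) : set M := [set x | forall a, A a -> a *: x = 0].

Lemma submod_ann A : submod (ann A).
Proof.
split=> [a _|b x y hx hy a Aa]; first by rewrite scaler0.
by rewrite scalerDr scalerA mulrC -scalerA hx // hy // scaler0 addr0.
Qed.

Definition sumset K L : set M := [set x | exists y z, [/\ K y, L z & x = y + z]].

Lemma submod_sumset K L : submod K -> submod L -> submod (sumset K L).
Proof.
move=> sK sL; split; first by exists 0, 0; rewrite addr0; split=> //; apply: submod0.
move=> a _ _ [y [z [Ky Lz ->]]] [y' [z' [Ky' Lz' ->]]].
exists (a *: y + y'), (a *: z + z'); split; [exact: sK.2|exact: sL.2|].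
by rewrite scalerDr addrACA.
Qed.

Lemma sub_sumsetl K L : submod L -> K `<=` sumset K L.
Proof. by move=> sL x Kx; exists x, 0; rewrite addr0; split=> //; apply: submod0. Qed.

Lemma sub_sumsetr K L : submod K -> L `<=` sumset K L.
Proof. by move=> sK x Lx; exists 0, x; rewrite add0r; split=> //; apply: submod0. Qed.

Definition scaled (a : R) K : set M := [set a *: x | x in K].

Lemma submod_scaled a K : submod K -> submod (scaled a K).
Proof.
move=> sK; split; first by exists 0; rewrite ?scaler0 //; apply: submod0.
move=> b _ _ [x Kx <-] [y Ky <-]; exists (b *: x + y); first exact: sK.2.
by rewrite scalerDr !scalerA mulrC.
Qed.

End Submodules.

Arguments ann {R M} A.

Lemma submod_preimage (R : comNzRingType) (M N : lmodType R)
    (f : {linear M -> N}) (K : set N) : submod K -> submod (f @^-1` K).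
Proof.
move=> [K0 hK]; split=> [|a x y Kx Ky]; first by rewrite /preimage /= linear0.
by rewrite /preimage /= linearP; apply: hK.
Qed.

Lemma submod_ker (R : comNzRingType) (M N : lmodType R) (f : {linear M -> N}) :
  submod [set x | f x = 0].
Proof.
by split=> [|a x y /= fx fy]; rewrite /= ?linear0 // linearP fx fy scaler0 addr0.
Qed.

Lemma submod_image (R : comNzRingType) (M N : lmodType R)
    (f : {linear M -> N}) (K : set M) : submod K -> submod (f @` K).
Proof.
move=> [K0 hK]; split; first by exists 0; rewrite ?linear0.
by move=> a _ _ [x Kx <-] [y Ky <-]; exists (a *: x + y); rewrite ?linearP //; apply: hK.
Qed.

(** * Ideals and primes of a noetherian ring *)

Section Ideals.
Variable R : comNzRingType.
Implicit Types (p q : {pred R}) (J K : set R^o).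

Definition mem_set_of p : set R^o := [set x | x \in p].

Lemma idealr_submod p : idealr_closed p -> submod (mem_set_of p).
Proof. by case=> p0 _ hp; split=> // a x y px py; apply: hp. Qed.

Lemma submod_idealr J : submod J -> ~ J 1 -> idealr_closed (fun x => `[< J x >]).
Proof.
move=> [J0 hJ] J1; split; [exact/asboolP|exact/asboolP|].
by move=> a x y /asboolP Jx /asboolP Jy; apply/asboolP; apply: hJ.
Qed.

Lemma eq_predP p q : {subset p <= q} -> {subset q <= p} -> p = q.
Proof.
move=> pq qp; apply/funext => x.
by apply/idP/idP => [/pq|/qp].
Qed.

Lemma neq_pred_sub p q : {subset p <= q} -> p <> q -> exists2 x, x \in q & x \notin p.
Proof.
move=> pq npq; apply: contrapT => h; apply: npq; apply: eq_predP => // x qx.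
by apply: contrapT => /negP px; apply: h; exists x.
Qed.

(** Minimality among submodules stands in for linear combinations: a property that cuts out a
    submodule need only be checked on [s]. *)
Definition generates (s : seq R) J :=
  (forall a, a \in s -> J a) /\
  forall K, submod K -> (forall a, a \in s -> K a) -> J `<=` K.

Lemma generates_ann (M : lmodType R) (s : seq R) J (x : M) :
  generates s J -> (forall a, a \in s -> a *: x = 0) ->
  forall a, J a -> a *: x = 0.
Proof.
move=> [_ sJ] sx; apply: (sJ [set a : R^o | a *: x = 0]) => //.
by split=> [|b a a' /= ax a'x]; rewrite /= ?scale0r // scalerDl -scalerA ax scaler0 add0r.
Qed.

Hypothesis noeth : noetherian R.

Lemma noetherian_generates J : submod J -> exists s, generates s J.
Proof.
move=> [J0 hJ].
have [|s hs] := noeth (I := fun x => `[< J x >]).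
  split=> [|a x y /asboolP Jx /asboolP Jy]; apply/asboolP => //.
  exact: hJ.
have JE x : J x <-> exists c : 'I_(size s) -> R, x = \sum_i c i * s`_i.
  by rewrite -hs; split=> [?|/asboolP//]; apply/asboolP.
exists s; split=> [a as_|K sK sKs x /JE[c ->]].
  have ai : (index a s < size s)%N by rewrite index_mem.
  apply/JE; exists (fun i => (i == Ordinal ai)%:R).
  rewrite (bigD1 (Ordinal ai)) //= eqxx mul1r nth_index // big1 ?addr0 //.
  by move=> i /negbTE ->; rewrite mul0r.
apply: (@big_ind _ K); [exact: sK.1|by move=> u v; apply: (@submodD R R^o K)|].
by move=> i _; apply: (@submodZ R R^o K) => //; apply: sKs; rewrite mem_nth.
Qed.

(** The union of the chain is an ideal, and its finitely many generators already lie in one term. *)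
Lemma noetherian_acc (F : nat -> set R^o) :
  (forall n, submod (F n)) -> (forall n, F n `<=` F n.+1) ->
  exists n, F n.+1 `<=` F n.
Proof.
move=> sF incF.
have [s [sU Umin]] := noetherian_generates (submod_bigcup sF incF).
have [n sn] : exists n, forall a, a \in s -> F n a.
  elim: s sU {Umin} => [|a s IH] sU; first by exists 0%N.
  have [|n sn] := IH; first by move=> b bs; apply: sU; rewrite inE bs orbT.
  have [k _ Fka] := sU a (mem_head _ _).
  have monF := monotone_chain incF.
  exists (maxn n k) => b; rewrite inE => /predU1P[->|/sn].
    by apply: monF Fka; rewrite leq_maxr.
  by apply: monF; rewrite leq_maxl.
exists n; apply: subset_trans (Umin _ (sF n) sn).
by move=> x Fx; exists n.+1.
Qed.

Lemma noetherian_maximal (Q : set R^o -> Prop) :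
  (exists J, Q J) -> (forall J, Q J -> submod J) ->
  exists J, Q J /\ forall K, Q K -> J `<=` K -> K `<=` J.
Proof.
move=> exQ sQ; apply: extremal_exists => // u Qu incu.
by apply: noetherian_acc => // n; apply: sQ.
Qed.

(** Take [Q] maximal among the ideals that contain [J] and no power of [x]. If [u] and [v] are
    outside [Q], both [Q + (u)] and [Q + (v)] contain powers of [x], whose product lies in
    [Q + (u v)]; hence [u v] is outside [Q]. *)
Lemma maximal_avoiding J (x : R) : submod J -> (forall n, ~ J (x ^+ n)) ->
  exists p, [/\ Spec p, J `<=` mem_set_of p, x \notin p &
    forall K, submod K -> mem_set_of p `<=` K -> (forall n, ~ K (x ^+ n)) ->
      K `<=` mem_set_of p].
Proof.
move=> sJ xJ.
have [|? []//|Q [[sQ JQ xQ] maxQ]] := noetherian_maximal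
  (Q := fun K => [/\ submod K, J `<=` K & forall n, ~ K (x ^+ n)]).
  by exists J; split.
have meet (u : R) : ~ Q u -> exists n a, Q (x ^+ n - a * u).
  move=> nQu; apply: contrapT => h; apply: nQu.
  have sK : submod [set y : R^o | exists a, Q (y - a * u)].
    split; first by exists 0; rewrite mul0r subr0; apply: submod0.
    move=> b y z [a Qa] [c Qc]; exists (b * a + c).
    have -> : b *: y + z - (b * a + c) * u = b *: (y - a * u : R^o) + (z - c * u).
      by rewrite scalerBr mulrDl opprD addrACA /GRing.scale /= mulrA.
    exact: sQ.2.
  have QK : Q `<=` [set y : R^o | exists a, Q (y - a * u)].
    by move=> y Qy; exists 0; rewrite mul0r subr0.
  apply: (maxQ _ _ QK).
    split=> //; first exact: subset_trans JQ QK.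
    by move=> n [a Qa]; apply: h; exists n, a.
  by exists 1; rewrite mul1r subrr; apply: submod0.
have Q1 : ~ Q 1 by have := xQ 0%N; rewrite expr0.
exists (fun y => `[< Q y >]); split.
- split; first exact: submod_idealr.
  move=> u v /asboolP Quv.
  apply: contrapT => /negP /norP[/asboolPn nQu /asboolPn nQv].
  have [i [a Qa]] := meet _ nQu; have [j [b Qb]] := meet _ nQv.
  apply: (xQ (i + j)%N).
  have -> : x ^+ (i + j) = x ^+ j *: (x ^+ i - a * u : R^o)
      + ((a * u) *: (x ^+ j - b * v : R^o) + (a * b) *: (u * v : R^o)).
    rewrite exprD /GRing.scale /= !mulrBr [x ^+ j * (a * u)]mulrC.
    rewrite [x ^+ j * _]mulrC (mulrACA a b u v) addrA -[in RHS]addrA.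
    by rewrite subrK addrNK.
  by apply: sQ.2 => //; apply: sQ.2 => //; apply: submodZ.
- by move=> y Jy; apply/asboolP; apply: JQ.
- by apply/asboolP; rewrite -[x]expr1; apply: xQ.
- move=> K sK QK xK y Ky; apply/asboolP; apply: (maxQ K) => //.
    split=> //; apply: subset_trans JQ _ => z Qz; apply: QK; exact/asboolP.
  by move=> z Qz; apply: QK; apply/asboolP.
Qed.

Lemma radical_prime J (x : R) : submod J ->
  (forall p, Spec p -> J `<=` mem_set_of p -> x \in p) -> exists n, J (x ^+ n).
Proof.
move=> sJ h; apply: contrapT => /forallNP nJ.
by have [p [/h pP /pP -> ]] := maximal_avoiding sJ nJ.
Qed.

Lemma exists_maximal_ideal p : idealr_closed p ->
  exists2 m, maximal_ideal m & Spec m /\ {subset p <= m}.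
Proof.
move=> ip.
(* Avoiding the powers of 1 is properness. *)
have [|m [Sm pm m1 maxm]] := maximal_avoiding (idealr_submod ip) (x := 1).
  by case: ip => _ p1 _ n; rewrite expr1n; apply/negP.
exists m => //; split=> [|K iK mK]; first exact: Sm.1.
apply: eq_predP => // y Ky; apply: (maxm (mem_set_of K)) => //.
  exact: idealr_submod.
by case: iK => _ K1 _ n; rewrite expr1n; apply/negP.
Qed.

End Ideals.

(** * Submodules as modules, and linear maps into them *)

Section SubmoduleTypes.
Variables (R : comNzRingType) (M : lmodType R) (K : set M) (sK : submod K).

Definition sub_pred of submod K : {pred M} := fun x => `[< K x >].

Lemma sub_pred_closed : submod_closed (sub_pred sK).
Proof.
split=> [|a x y /asboolP Kx /asboolP Ky]; apply/asboolP; first exact: submod0.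
exact: sK.2.
Qed.

HB.instance Definition _ :=
  GRing.isSubmodClosed.Build R M (sub_pred sK) sub_pred_closed.

Definition sub_mod : Type := {x : M | sub_pred sK x}.

HB.instance Definition _ := [isSub of sub_mod for @sval M (sub_pred sK)].
HB.instance Definition _ := [Choice of sub_mod by <:].
HB.instance Definition _ := [SubChoice_isSubZmodule of sub_mod by <:].
HB.instance Definition _ := [SubZmodule_isSubLmodule of sub_mod by <:].

Lemma sub_mod_embedding : exists (L : lmodType R) (f : {linear L -> M}),
  injective f /\ range f = K.
Proof.
exists sub_mod, (val : {linear sub_mod -> M}); split; first exact: val_inj.
apply/seteqP; split=> [_ [x _ <-]|x Kx]; first exact/asboolP/(valP x).
by exists (exist _ x (asboolT Kx)).
Qed.

End SubmoduleTypes.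

Lemma linear_factor (R : comNzRingType) (A B M : lmodType R)
    (f : {linear A -> M}) (g : {linear B -> M}) :
  injective g -> range f `<=` range g ->
  exists k : {linear A -> B}, forall x, g (k x) = f x.
Proof.
move=> gI fg.
have ex x : exists y, g y = f x by have [y _ gy] := fg _ (imageT f x); exists y.
have [k gk] := choice ex.
have klin : linear k by move=> a x y; apply: gI; rewrite linearP !gk linearP.
pose kL := GRing.isLinear.Build R A B *:%R k klin.
by exists (HB.pack_for {linear A -> B} k kL).
Qed.

Lemma linear_scale (R : comNzRingType) (M : lmodType R) (a : R) :
  exists h : {linear M -> M}, forall x, h x = a *: x.
Proof.
have hlin : linear (fun x : M => a *: x).
  by move=> b x y; rewrite scalerDr !scalerA mulrC.
pose hL := GRing.isLinear.Build R M M *:%R _ hlin.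
by exists (HB.pack_for {linear M -> M} (fun x : M => a *: x) hL).
Qed.

(** * Serre subcategories tested on submodules *)

Section SerreSubmodules.
Variables (R : comNzRingType) (S : lmodType R -> Prop).
Hypothesis serreS : serre_subcategory S.

(* Membership in S of a submodule of M, up to isomorphism. *)
Definition Sin (M : lmodType R) (K : set M) : Prop :=
  exists (L : lmodType R) (f : {linear L -> M}),
    [/\ injective f, range f = K & S L].

(** Injections with the same range factor through one another, so the choice of embedding in [Sin]
    is immaterial. *)
Lemma Sin_range (L M : lmodType R) (f : {linear L -> M}) :
  injective f -> Sin (range f) <-> S L.
Proof.
move=> fI; split=> [[L' [g [gI gf SL']]]|SL]; last by exists L, f.
have [|k gk] := linear_factor (f := f) gI; first by rewrite gf.
by apply: (serre_sub serreS (f := k)) SL' => x y kxy; apply: fI; rewrite -!gk kxy.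
Qed.

Lemma range_ann_mod (I : {pred R}) (M : lmodType R) :
  range (val : ann_mod I M -> M) = ann (mem_set_of I).
Proof.
apply/seteqP; split=> [_ [x _ <-]|x Ix]; first exact/asboolP/(valP x).
by exists (exist _ x (asboolT Ix)).
Qed.

Lemma Sin_ann_mod (I : {pred R}) (M : lmodType R) :
  Sin (ann (mem_set_of I) : set M) <-> S (ann_mod I M).
Proof.
rewrite -range_ann_mod.
exact: (@Sin_range _ _ (val : {linear ann_mod I M -> M}) val_inj).
Qed.

Lemma Sin_setT (M : lmodType R) : Sin [set: M] <-> S M.
Proof.
rewrite -(image_id [set: M]).
exact: (@Sin_range _ _ (idfun : {linear M -> M})).
Qed.

Lemma Sin_sub (M : lmodType R) (K K' : set M) :
  submod K' -> K' `<=` K -> Sin K -> Sin K'.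
Proof.
move=> sK' K'K [L [f [fI fK SL]]].
have [L' [g [gI gK']]] := sub_mod_embedding sK'.
exists L', g; split=> //.
have [|k fk] := linear_factor (f := g) fI; first by rewrite gK' fK.
by apply: (serre_sub serreS (f := k)) SL => x y kxy; apply: gI; rewrite -!fk kxy.
Qed.

(** [K] is an extension of its image under [h] by its intersection with the kernel of [h]. *)
Lemma Sin_ext (M N : lmodType R) (h : {linear M -> N}) (K : set M) :
  submod K -> Sin (K `&` [set x | h x = 0]) -> Sin (h @` K) -> Sin K.
Proof.
move=> sK [A [f [fI fK SA]]] [B [g [gI gK SB]]].
have [L [j [jI jK]]] := sub_mod_embedding sK.
exists L, j; split=> //.
have [|k jk] := linear_factor (f := f) jI; first by rewrite jK fK => x [].
have [|l gl] := linear_factor (f := h \o j) gI.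
  by rewrite gK -jK => _ [x _ <-] /=; exists (j x) => //; exists x.
have kI : injective k by move=> x y kxy; apply: fI; rewrite -!jk kxy.
apply: (serre_ext serreS kI (g := l)) => //.
  apply/seteqP; split=> [_ [x _ <-]|x /= lx].
    apply: gI; rewrite gl linear0 /= jk.
    have : range f (f x) by exists x.
    by rewrite fK => -[].
  have : range f (j x).
    rewrite fK; split; first by rewrite -jK.
    by have := gl x; rewrite lx linear0.
  by move=> [y _ fy]; exists y => //; apply: jI; rewrite jk.
apply/seteqP; split=> // y _.
have : range g (g y) by exists y.
rewrite gK -jK => -[_ [z _ <-] hz]; exists z => //.
by apply: gI; rewrite gl.
Qed.

(** Induction on [n] along multiplication by [a]: its kernel on [K] is in the class, and its image
    [aK] is killed by a lower power of [a] and meets the kernel of [a] inside [K]. *)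
Lemma Sin_nilpotent (M : lmodType R) (a : R) n (K : set M) :
  submod K -> (forall x, K x -> a ^+ n *: x = 0) ->
  Sin (K `&` [set x | a *: x = 0]) -> Sin K.
Proof.
have [h hE] := linear_scale M a.
elim: n K => [|n IH] K sK aK Ka.
  apply: Sin_sub Ka => // x Kx; have := aK x Kx.
  by rewrite expr0 scale1r => ->; split; [exact: submod0|rewrite /= scaler0].
apply: (@Sin_ext M M h) => //; first by under eq_fun do rewrite hE.
have shK := submod_image h sK.
apply: IH => // [_ [x Kx <-]|].
  by rewrite hE scalerA -exprSr aK.
apply: Sin_sub Ka; first by apply: submodI => //; apply: submod_scaler_ker.
by move=> _ [[x Kx <-] /= ax]; split=> //; rewrite hE; apply: submodZ.
Qed.

(** The elements of [s] are peeled off one at a time. For generators of an ideal [I], this lifts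
    membership from the part of [K] killed by [I] to [K] itself. *)
Lemma Sin_nilpotent_seq (M : lmodType R) (s : seq R) (K : set M) :
  submod K -> (forall a, a \in s -> exists n, forall x, K x -> a ^+ n *: x = 0) ->
  Sin (K `&` ann (fun a => a \in s)) -> Sin K.
Proof.
elim: s K => [|a s IH] K sK nilK Ks.
  by apply: Sin_sub Ks => // x Kx; split=> // a; rewrite in_nil.
have [n an] := nilK a (mem_head _ _).
apply: Sin_nilpotent an _ => //.
have sKa : submod (K `&` [set x | a *: x = 0]).
  by apply: submodI => //; apply: submod_scaler_ker.
apply: IH => //.
  move=> b bs; have [k bk] := nilK b (mem_behead (s := a :: s) bs).
  by exists k => x [/bk].
apply: Sin_sub Ks; first by apply: submodI => //; apply: submod_ann.
move=> x [[Kx ax] sx]; split=> // b; rewrite in_cons => /predU1P[->//|].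
exact: sx.
Qed.

End SerreSubmodules.

Lemma Gamma_pow (R : comNzRingType) (M : lmodType R) (I : {pred R}) (x : M) a :
  Gamma I M x -> a \in I -> exists n, a ^+ n *: x = 0.
Proof.
move=> [n _ Ix] aI; exists n; apply: Ix.
exists 1%N, (fun=> 1), (fun _ _ => a); split=> //.
by rewrite big_ord1 mul1r prodr_const card_ord.
Qed.

(** * The Melkersson condition for nilpotent ideals and for sums of ideals *)

Section MelkerssonClosure.
Variables (R : comNzRingType) (S : lmodType R -> Prop).
Hypotheses (serreS : serre_subcategory S) (noeth : noetherian R).

Lemma ann_generates (M : lmodType R) (s : seq R) (J : set R^o) :
  generates s J -> (ann (fun a => a \in s) : set M) `<=` ann J.
Proof. by move=> sJ x sx; apply: generates_ann sJ _. Qed.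

(** Generators of [q] are nilpotent in [R], so each acts on every module with a fixed nilpotency
    exponent. *)
Lemma melkersson_nilpotent (q : {pred R}) : idealr_closed q ->
  (forall a, a \in q -> exists n, a ^+ n = 0) -> melkersson S q.
Proof.
move=> iq nilq M _ Sq; apply/(Sin_setT serreS).
have [s qs] := noetherian_generates noeth (idealr_submod iq).
apply: (Sin_nilpotent_seq serreS (s := s)) => // [a /qs.1 /nilq [n an]|].
  by exists n => x _; rewrite an scale0r.
move/(Sin_ann_mod serreS): Sq; apply: Sin_sub => //.
  by apply: submodI => //; apply: submod_ann.
by move=> x [_ sx]; apply: ann_generates sx.
Qed.

(** The conditions for [p1] and then [p2] reduce the claim to the submodule of [M] killed by
    [p1 + p2]. Every [a] in [m] acts nilpotently there, with an exponent depending only on [a], so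
    the part killed by [m] decides membership. *)
Lemma melkersson_join (p1 p2 m : {pred R}) :
  idealr_closed m -> {subset p1 <= m} -> {subset p2 <= m} ->
  (forall a, a \in m ->
     exists n, sumset (mem_set_of p1) (mem_set_of p2) (a ^+ n)) ->
  melkersson S p1 -> melkersson S p2 -> melkersson S m.
Proof.
move=> im p1m p2m rad C1 C2 M tors Sm.
(* Torsion passes to modules embedded in [M] and to subsets of [m]. *)
have sub_tors (I : {pred R}) (L : lmodType R) (f : {linear L -> M}) :
    injective f -> {subset I <= m} -> Gamma I L = setT.
  move=> fI Im; apply/seteqP; split=> // x _.
  have : Gamma m M (f x) by rewrite tors.
  move=> [n n0 hn]; exists n => // a [k [c [b [bI aE]]]].
  apply: fI; rewrite linear0 linearZ /=; apply: hn.
  by exists k, c, b; split=> // i j; apply: Im.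
apply: C1; first exact: (sub_tors _ _ (idfun : {linear M -> M})).
pose v1 : {linear ann_mod p1 M -> M} := val.
have v1I : injective v1 by apply: val_inj.
apply: C2; first exact: (sub_tors _ _ v1).
pose v2 : {linear ann_mod p2 (ann_mod p1 M) -> ann_mod p1 M} := val.
have v2I : injective v2 by apply: val_inj.
apply/(Sin_range serreS (f := v1 \o v2)); first exact: inj_comp.
have sK := submod_image (v1 \o v2) (submodT _).
have [s ms] := noetherian_generates noeth (idealr_submod im).
apply: (Sin_nilpotent_seq serreS (s := s)) => // [a /ms.1 /rad [n]|].
  move=> [b [c [b1 c2 bc]]]; exists n => _ [x _ <-]; rewrite bc scalerDl.
  have /asboolP -> // := valP (val x).
  rewrite add0r; have /asboolP cx := valP x.
  transitivity (v1 ((c : R) *: v2 x)); first by rewrite linearZ.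
  by rewrite cx // linear0.
move/(Sin_ann_mod serreS): Sm; apply: Sin_sub => //.
  by apply: submodI => //; apply: submod_ann.
by move=> x [_ sx]; apply: ann_generates sx.
Qed.

End MelkerssonClosure.

(** * Primes and loci in dimension at most two *)

Section Dimension.
Variable R : comNzRingType.
Implicit Types p q m : {pred R}.

(** The form of strict inclusion that appears in [prime_chain]. *)
Definition ssub p q : Prop := {subset p <= q} /\ ~ {subset q <= p}.

Lemma ssubP p q : {subset p <= q} -> p <> q -> ssub p q.
Proof. by move=> pq npq; split=> // qp; apply: npq; apply: eq_predP. Qed.

Lemma ssub_trans p q m : ssub p q -> ssub q m -> ssub p m.
Proof.
move=> [pq _] [qm mq]; split=> [x /pq /qm //|mp].
by apply: mq => x /mp /pq.
Qed.

Lemma prime_chain2 p q : Spec p -> Spec q -> ssub p q ->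
  prime_chain (fun i : 'I_2 => nth p [:: p; q] i).
Proof.
move=> Sp Sq pq; split; first by case=> [[|[|]]].
by case=> [[|[|]] // ?] [[|[|]] // ?].
Qed.

Lemma prime_chain4 p0 p1 p2 p3 :
  [/\ Spec p0, Spec p1, Spec p2 & Spec p3] ->
  [/\ ssub p0 p1, ssub p1 p2 & ssub p2 p3] ->
  prime_chain (fun i : 'I_4 => nth p0 [:: p0; p1; p2; p3] i).
Proof.
move=> [S0 S1 S2 S3] [h01 h12 h23].
have h02 := ssub_trans h01 h12; have h13 := ssub_trans h12 h23.
have h03 := ssub_trans h01 h13.
split; first by case=> [[|[|[|[|]]]]].
by case=> [[|[|[|[|]]]] // ?] [[|[|[|[|]]]] // ?].
Qed.

Lemma krull_dim_le2P p0 p1 p2 p3 : krull_dim_le R 2 ->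
  Spec p0 -> Spec p1 -> Spec p2 -> Spec p3 ->
  ssub p0 p1 -> ssub p1 p2 -> ssub p2 p3 -> False.
Proof.
move=> d2 S0 S1 S2 S3 h01 h12 h23.
have c4 : [/\ Spec p0, Spec p1, Spec p2 & Spec p3] by [].
have h4 : [/\ ssub p0 p1, ssub p1 p2 & ssub p2 p3] by [].
by have := d2 _ _ (prime_chain4 c4 h4).
Qed.

(** Descending from [p] through non-minimal primes must stop within three steps, since a fourth
    prime would give a chain of length 3. It stops at [q]. *)
Lemma unique_minimal_prime_sub q p : krull_dim_le R 2 ->
  unique_minimal_prime q -> Spec p -> {subset q <= p}.
Proof.
move=> d2 [mq uq] Sp.
have step p' : Spec p' -> {subset p' <= p} -> {subset q <= p} \/
    exists p'', Spec p'' /\ ssub p'' p'.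
  move=> Sp' p'p; have [mp'|nmp'] := pselect (minimal_prime p').
    by left; rewrite -(uq _ mp').
  right; apply: contrapT => h; apply: nmp'; split=> // r Sr rp'.
  by apply: contrapT => nr; apply: h; exists r; split=> //; apply: ssubP.
have [//|[p1 [S1 h1]]] := step p Sp (fun _ => id).
have [//|[p2 [S2 h2]]] := step p1 S1 h1.1.
have [|//|[p3 [S3 h3]]] := step p2 S2; first exact: (ssub_trans h2 h1).1.
by have := krull_dim_le2P d2 S3 S2 S1 Sp h3 h2 h1.
Qed.

Lemma local_max (m : {pred R}) : noetherian R -> local_ring R -> maximal_ideal m ->
  Spec m /\ forall p, Spec p -> {subset p <= m}.
Proof.
move=> noeth [m' [_ um]] mm.
have h p : idealr_closed p -> Spec m /\ {subset p <= m}.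
  move=> /(exists_maximal_ideal noeth)[m1 mm1 h1].
  by rewrite -(um _ mm) (um _ mm1).
split=> [|p [ip _]]; last exact: (h p ip).2.
exact: (h m mm.1).1.
Qed.

End Dimension.

Lemma locus_dim_le2 (R : comNzRingType) (q : {pred R}) (S : lmodType R -> Prop) :
  noetherian R -> local_ring R -> unique_minimal_prime q -> krull_dim_le R 2 ->
  serre_subcategory S -> locus_form_a q S \/ locus_form_b q S.
Proof.
move=> noeth loc uq d2 serreS.
have [m [mm _]] := loc.
have [Sm pm] := local_max noeth loc mm.
have qp p := unique_minimal_prime_sub (p := p) d2 uq.
have Sq : Spec q by case: uq => -[].
have Mq : melkersson_locus S q.
  split=> //; apply: (melkersson_nilpotent serreS noeth Sq.1) => a qa.
  (* Lying in every prime, [q] lies in the radical of zero. *)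
  apply: (radical_prime noeth (J := [set 0])) => [|p Sp _]; last exact: qp.
  by split=> // b x y -> ->; rewrite scaler0 addr0.
(* A further prime between [p1] and [m] would give the chain [q < p1 < p2 < m]. *)
have eq_or_m p1 p2 : Spec p1 -> Spec p2 -> p1 <> q -> {subset p1 <= p2} ->
    p2 = p1 \/ p2 = m.
  move=> S1 S2 n1 h12.
  have [<-|n12] := pselect (p1 = p2); first by left.
  have [|n2] := pselect (p2 = m); first by right.
  case: (krull_dim_le2P d2 Sq S1 S2 Sm).
  - by apply: ssubP (qp _ S1) _ => /esym.
  - exact: ssubP.
  - exact: ssubP (pm _ S2) _.
have [Mm|nMm] := pselect (melkersson_locus S m).
  (* [q] is removed from [W], because every prime contains it and [W] would have to be all of the
     spectrum. *)
  left; exists (melkersson_locus S `\` [set q]); split; last first.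
    by rewrite setDE setUIr setUv setIT; apply/esym/setUidPr => _ ->.
  split=> [p [[]]//|p p' [Mp np] Sp' pp'].
  have np' : p' <> q.
    by move=> p'q; apply: np; apply: eq_predP (qp _ Mp.1); rewrite -p'q.
  by have [->|->] := eq_or_m p p' Mp.1 Sp' np pp'; split=> // mq; apply: np';
    apply: eq_predP (qp _ Sp'); rewrite -mq; apply: pm.
have [[p [Mp np]]|none] := pselect (exists p, melkersson_locus S p /\ p <> q).
  right; exists p; have Sp := Mp.1.
  have npm : p <> m by move=> pm'; apply: nMm; rewrite -pm'.
  have hqp : ssub q p by apply: ssubP (qp _ Sp) _ => /esym.
  have hpm : ssub p m by apply: ssubP (pm _ Sp) _.
  split=> //.
    split; first by exists (fun i : 'I_2 => nth q [:: q; p] i); split; [exact: prime_chain2|].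
    (* A chain of length at least 2 ending at [p] continues to [m], giving four primes. *)
    move=> k c [Sc inc] cp; rewrite leqNgt; apply/negP => k2.
    have k1 : (1 < k.+1)%N by rewrite ltnS ltnW.
    apply: (krull_dim_le2P d2 (Sc ord0) (Sc (Ordinal k1)) Sp Sm _ _ hpm).
      exact: inc.
    by rewrite -cp; apply: inc.
  apply/seteqP; split=> [p' Mp'|p' [->//|->//]].
  have [->|np'q] := pselect (p' = q); [by left|right].
  (* A second prime [p'] would leave [m] as the only prime over [p + p'], and thus put [m] into the
     locus. *)
  apply: contrapT => np'p; apply: nMm; split=> //.
  apply: (melkersson_join serreS noeth Sm.1 (pm _ Sp) (pm _ Mp'.1)) Mp.2 Mp'.2.
  have sp := idealr_submod Sp.1; have sp' := idealr_submod Mp'.1.1.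
  move=> a am; apply: (radical_prime noeth (submod_sumset sp sp')) => Q SQ JQ.
  have hpQ : {subset p <= Q} by move=> x px; apply: JQ; apply: sub_sumsetl.
  have hp'Q : {subset p' <= Q} by move=> x px; apply: JQ; apply: sub_sumsetr.
  have [Qp|->//] := eq_or_m _ _ Sp SQ np hpQ.
  have [Qp'|->//] := eq_or_m _ _ Mp'.1 SQ np'q hp'Q.
  by case: np'p; rewrite -Qp -Qp'.
(* The locus is [q] alone, which is form (a) with empty [W]. *)
left; exists set0; split; first by split.
rewrite setU0; apply/seteqP; split=> [p Mp|p -> //].
by apply: contrapT => np; apply: none; exists p.
Qed.

(** * Artinian submodules and Melkersson's criterion *)

Section Artinian.
Variable R : comNzRingType.

(** Stated for a subset of a fixed module, so that kernels, images and intersections need no module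
    type of their own. *)
Definition artinian (M : lmodType R) (K : set M) : Prop :=
  forall F : nat -> set M, (forall n, submod (F n)) ->
    (forall n, F n `<=` K) -> (forall n, F n.+1 `<=` F n) ->
    exists n, forall k, (n <= k)%N -> F n `<=` F k.

Lemma artinian_sub (M : lmodType R) (K L : set M) :
  L `<=` K -> artinian K -> artinian L.
Proof. by move=> LK aK F sF FL; apply: aK => // n; apply: subset_trans LK. Qed.

Lemma artinian_minimal (M : lmodType R) (K : set M) (Q : set M -> Prop) :
  artinian K -> (exists L, Q L) -> (forall L, Q L -> submod L /\ L `<=` K) ->
  exists L, Q L /\ forall L', Q L' -> L' `<=` L -> L `<=` L'.
Proof.
move=> aK exQ hQ.
have [//|u Qu decu|L [QL minL]] := @extremal_exists _ Q (fun L L' => L' `<=` L).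
  have [||//|n hn] := aK u; try by move=> n; have [] := hQ _ (Qu n).
  by exists n; apply: hn.
by exists L.
Qed.

Lemma artinian_pull (L M : lmodType R) (f : {linear L -> M}) (K : set M) :
  injective f -> artinian K -> artinian (f @^-1` K).
Proof.
move=> fI aK F sF FK decF.
have [n|n|n|n hn] := aK (fun n => f @` F n).
- exact: submod_image.
- by move=> _ [x /FK Kx <-].
- by apply: image_subset.
exists n => k nk x Fx; have [|y Fy /fI <-//] := hn k nk (f x).
by exists x.
Qed.

Lemma artinian_range (L M : lmodType R) (f : {linear L -> M}) :
  artinian [set: L] -> artinian (range f).
Proof.
move=> aL F sF FK decF.
have [n|//|n|n hn] := aL (fun n => f @^-1` F n).
- exact: submod_preimage.
- exact: preimage_subset.
exists n => k nk y Fy; have [x _ fx] := FK _ _ Fy.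
by rewrite -fx; apply: (hn k nk); rewrite /preimage /= fx.
Qed.

(* Modular law: a submodule of [K] is determined, within a larger one, by its
   trace on the kernel of [h] and its image under [h]. *)
Lemma artinian_ext (M N : lmodType R) (h : {linear M -> N}) (K : set M) :
  artinian (K `&` [set x | h x = 0]) -> artinian (h @` K) -> artinian K.
Proof.
move=> aker aim F sF FK decF.
have sker := submod_ker h.
have [n|n|n|i hi] := aker (fun n => F n `&` [set x | h x = 0]).
- exact: submodI.
- exact: setSI.
- exact: setSI.
have [n|n|n|j hj] := aim (fun n => h @` F n).
- exact: submod_image.
- exact: image_subset.
- exact: image_subset.
exists (maxn i j) => k; rewrite geq_max => /andP[ik jk] x Fx.
have decle := antitone_chain decF.
have [|y Fy hy] := hj k jk (h x).
  by exists x => //; apply: decle Fx; rewrite leq_maxr.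
have -> : x = (x - y) + y by rewrite subrK.
apply: (submodD (sF k)) (Fy); apply: (hi k ik _ _).1; split; last first.
  by rewrite /= linearB hy subrr.
apply: (submodB (sF i)); first by apply: decle Fx; rewrite leq_maxl.
exact: decle ik _ (Fy).
Qed.

(* The dual of the Hilbert basis argument: [K] is controlled by the "leading
   coefficient" submodules [a^i K ∩ ker a], which decrease with [i] and [K]. *)
Lemma artinian_torsion (M : lmodType R) (a : R) (K : set M) :
  submod K -> (forall x, K x -> exists n, a ^+ n *: x = 0) ->
  artinian (K `&` [set x | a *: x = 0]) -> artinian K.
Proof.
move=> sK tors aA F sF FK decF.
pose G i n : set M := scaled (a ^+ i) (F n) `&` [set x | a *: x = 0].
have sG i n : submod (G i n).
  by apply: submodI; [apply: submod_scaled|apply: submod_scaler_ker].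
have GA i n : G i n `<=` K `&` [set x | a *: x = 0].
  by apply: setSI => _ [x /FK Kx <-]; apply: submodZ.
have decGn i n : G i n.+1 `<=` G i n.
  by apply: setSI; apply: image_subset; apply: decF.
have decGi n i : G i.+1 n `<=` G i n.
  apply: setSI => _ [x Fx <-]; rewrite exprSr -scalerA.
  by exists (a *: x) => //; apply: submodZ.
have Gle i j n k : (i <= j)%N -> (n <= k)%N -> G j k `<=` G i n.
  move=> ij nk; apply: subset_trans (antitone_chain (decGn i) nk).
  exact: (antitone_chain (decGi k) ij).
(* The diagonal stabilizes at [d], which settles all [i >= d] at once; the finitely many rows
   [i < d] are then stabilized separately. *)
have [|n|n|d hd] := aA (fun n => G n n) => //; first by apply: Gle; rewrite leqnSn.
have [n hn] : exists n, forall i k, (i < d)%N -> (n <= k)%N -> G i n `<=` G i k.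
  elim: d {hd} => [|d [n hn]]; first by exists 0%N.
  have [//|//|//|n' hn'] := aA (G d).
  exists (maxn n n') => i k id; rewrite geq_max => /andP[nk n'k].
  move: id; rewrite ltnS leq_eqVlt => /predU1P[->|id].
    by apply: subset_trans (hn' k n'k); apply: Gle; rewrite ?leq_maxr.
  by apply: subset_trans (hn i k id nk); apply: Gle; rewrite ?leq_maxl.
exists (maxn d n) => k; rewrite geq_max => /andP[dk nk].
have GNk i : G i (maxn d n) `<=` G i k.
  have [id|di] := ltnP i d.
    by apply: subset_trans (hn i k id nk); apply: Gle; rewrite ?leq_maxr.
  apply: subset_trans (_ : G d d `<=` _); first by apply: Gle; rewrite ?leq_maxl.
  have dm : (d <= maxn i k)%N by rewrite leq_max di.
  by apply: subset_trans (hd _ dm) _; apply: Gle; rewrite ?leq_maxl ?leq_maxr.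
have Fk : F k `<=` F (maxn d n) by apply: antitone_chain => //; rewrite geq_max dk.
move=> x Fx; have [j] := tors x (FK _ _ Fx).
(* Induction on the exponent killing [x]: some [y] in [F k] satisfies [a^j y = a^j x], and [x - y]
   is killed by the lower power [a^j]. *)
elim: j x Fx => [|j IH] x Fx ajx.
  by move: ajx; rewrite expr0 scale1r => ->; apply: submod0.
have [|[y Fy ay] _] := GNk j (a ^+ j *: x).
  by split; [exists x|rewrite /= scalerA -exprS].
rewrite -(subrK y x); apply: (submodD (sF k)) (Fy); apply: IH.
  by apply: submodB => //; apply: Fk.
by rewrite scalerBr ay subrr.
Qed.

(** Applied to generators of an ideal, one at a time, this is Melkersson's criterion. *)
Lemma artinian_torsion_seq (M : lmodType R) (s : seq R) (K : set M) :
  submod K -> (forall a x, a \in s -> K x -> exists n, a ^+ n *: x = 0) ->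
  artinian (K `&` ann (fun a => a \in s)) -> artinian K.
Proof.
elim: s K => [|a s IH] K sK tors Ks.
  by apply: artinian_sub Ks => x Kx; split=> // a; rewrite in_nil.
apply: (@artinian_torsion M a) => // [x Kx|]; first exact: tors (mem_head _ _) Kx.
have sKa : submod (K `&` [set x | a *: x = 0]).
  by apply: submodI => //; apply: submod_scaler_ker.
apply: IH => //.
  by move=> b x bs [Kx _]; apply: tors => //; rewrite inE bs orbT.
apply: artinian_sub Ks => x [[Kx ax] sx]; split=> // b.
by rewrite in_cons => /predU1P[->//|]; apply: sx.
Qed.

Fixpoint lin_span (M : lmodType R) (s : seq M) : set M :=
  if s is v :: s' then [set x | exists c w, lin_span s' w /\ x = c *: v + w]
  else [set 0].

Lemma submod_lin_span (M : lmodType R) (s : seq M) : submod (lin_span s).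
Proof.
elim: s => [|v s [s0 IH]] /=.
  by split=> // a x y -> ->; rewrite scaler0 addr0.
split; first by exists 0, 0; rewrite scale0r addr0.
move=> a _ _ [c [w [sw ->]]] [c' [w' [sw' ->]]].
exists (a * c + c'), (a *: w + w'); split; first exact: IH.
by rewrite scalerDr scalerDl addrACA scalerA.
Qed.

(** If [m + (c)] were proper, maximality would put [c] into [m]; so [c] is invertible modulo [m]. *)
Lemma maximal_inv (m : {pred R}) (c : R) : maximal_ideal m -> c \notin m ->
  exists b, 1 - b * c \in m.
Proof.
move=> [im maxm] cm; apply: contrapT => nb.
have sm := idealr_submod im.
have sJ : submod (sumset (mem_set_of m) (range (fun b : R^o => b * c : R^o))).
  apply: submod_sumset => //; split; first by exists 0; rewrite ?mul0r.
  by move=> a _ _ [x _ <-] [y _ <-]; exists (a * x + y) => //; rewrite mulrDl -mulrA.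
have J1 : ~ sumset (mem_set_of m) (range (fun b : R^o => b * c : R^o)) 1.
  by move=> [y [_ [my [b _ <-] h]]]; apply: nb; exists b; rewrite h addrK.
have Jm := maxm _ (submod_idealr sJ J1).
move/negP: cm; apply; rewrite -Jm.
  apply/asboolP; exists 0, c; rewrite add0r; split=> //; first exact: (submod0 sm).
  by exists 1; rewrite ?mul1r.
move=> x mx; apply/asboolP; exists x, 0; rewrite addr0; split=> //.
by exists 0; rewrite ?mul0r.
Qed.

(** The span is a finite-dimensional vector space over [R/m]. Either some [F j] has no vector with
    coefficient 1 at the head [v], and then lies in the span of the tail, or every [F j] has one and
    is determined by its trace on that span. *)
Lemma artinian_lin_span (M : lmodType R) (m : {pred R}) (s : seq M) :
  maximal_ideal m -> (forall a v, a \in m -> v \in s -> a *: v = 0) ->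
  artinian (lin_span s).
Proof.
move=> mm; elim: s => [|v s IH] ms F sF Fs decF.
  by exists 0%N => k _ x /Fs ->; apply: submod0.
have ms' a u : a \in m -> u \in s -> a *: u = 0.
  by move=> am us; apply: ms => //; rewrite inE us orbT.
have decle := antitone_chain decF.
have [[j Nj]|all] := pselect (exists j, forall w, lin_span s w -> ~ F j (v + w)).
  have Fspan k : F (j + k)%N `<=` lin_span s.
    move=> x Fx; have [c [w [sw xE]]] := Fs _ _ Fx.
    (* A head coefficient outside [m] could be rescaled to 1, against the choice of [j]. *)
    have [cm|/(maximal_inv mm)[b bc]] := boolP (c \in m).
      by rewrite xE ms ?mem_head // add0r.
    case: (Nj (b *: w)); first exact: (submodZ _ (submod_lin_span s)).
    have -> : v + b *: w = b *: x.
      rewrite xE scalerDr scalerA; congr (_ + _); apply/eqP; rewrite -subr_eq0.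
      by rewrite -{1}[v]scale1r -scalerBl ms ?mem_head.
    by apply: (submodZ _ (sF j)); apply: decle Fx; rewrite leq_addr.
  have [|//|n|n hn] := IH ms' (fun k => F (j + k)%N); first by [].
    by rewrite addnS; apply: decF.
  exists (j + n)%N => k jnk; rewrite -(subnKC (leq_trans (leq_addr n j) jnk)).
  by apply: hn; rewrite leq_subRL // (leq_trans (leq_addr n j)).
have [|n|n|n hn] := IH ms' (fun k => F k `&` lin_span s).
- by move=> n; apply: submodI => //; apply: submod_lin_span.
- by move=> x [].
- exact: setSI.
exists n => k nk x Fx; have [c [w [sw xE]]] := Fs _ _ Fx.
have [w' [sw' Fw']] : exists w', lin_span s w' /\ F k (v + w').
  by apply: contrapT => h; apply: all; exists k => w' sw' Fw'; apply: h; exists w'.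
rewrite -(subrK (c *: (v + w')) x).
have cF : F k (c *: (v + w')) by apply: submodZ.
apply: (submodD (sF k)) cF; apply: (hn k nk _ _).1; split.
  by apply: (submodB (sF n)) => //; apply: submodZ => //; apply: decle Fw'.
rewrite xE scalerDr opprD addrACA subrr add0r.
by apply: (submodB (submod_lin_span s)) => //; apply: (submodZ _ (submod_lin_span s)).
Qed.

End Artinian.

(** * Modules killed by a member of a family of sets *)

Section Killed.
Variable R : comNzRingType.
Variable T : set (set R).

(** Two families [T] are used: the singletons of elements outside a prime, and the sets of n-fold
    products from an ideal. *)
Definition killed (M : lmodType R) : Prop :=
  exists2 A, T A & (ann A : set M) = setT.

Hypothesis T0 : exists A, T A.
Hypothesis TM : forall A B, T A -> T B ->
  exists2 C, T C & C `<=` [set a * b | a in A & b in B].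

(** An extension is killed by products of elements killing its two ends. *)
Lemma serre_killed : serre_subcategory killed.
Proof.
split=> [|L M f fI [A TA AM]|M N g gT [A TA AM]|L M N f g fI fg gT [A TA AL] [B TB BN]].
- have [A TA] := T0; exists 'rV[R]_0, A => //.
  by apply/seteqP; split=> // x _ a _; apply/rowP => -[].
- exists A => //; apply/seteqP; split=> // x _ a Aa; apply: fI.
  have : (ann A : set M) (f x) by rewrite AM.
  by rewrite linearZ linear0; apply.
- exists A => //; apply/seteqP; split=> // y _ a Aa.
  have : range g y by rewrite gT.
  move=> [x _ <-]; have : (ann A : set M) x by rewrite AM.
  by move=> Ax; rewrite -linearZ /= Ax // linear0.
- have [C TC CAB] := TM TA TB; exists C => //; apply/seteqP; split=> // x _ c Cc.
  have [a Aa [b Bb <-]] := CAB _ Cc.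
  have : (ann B : set N) (g x) by rewrite BN.
  move=> /(_ b Bb) gbx.
  have : range f (b *: x) by rewrite fg /= linearZ.
  move=> [y _ fy]; rewrite -scalerA -fy -linearZ /=.
  have : (ann A : set L) y by rewrite AL.
  by move=> -> //; rewrite linear0.
Qed.

Lemma Sin_killed (M : lmodType R) (K : set M) : submod K ->
  Sin killed K <-> exists2 A, T A & K `<=` ann A.
Proof.
move=> sK; split=> [[L [f [fI fK [A TA AL]]]]|[A TA AK]].
  exists A => // x; rewrite -fK => -[y _ <-] a Aa; rewrite -linearZ /=.
  have : (ann A : set L) y by rewrite AL.
  by move=> -> //; rewrite linear0.
have [L [f [fI fK]]] := sub_mod_embedding sK.
exists L, f; split=> //; exists A => //; apply/seteqP; split=> // y _ a Aa.
apply: fI; rewrite linear0 linearZ; apply: AK => //.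
by rewrite -fK; exists y.
Qed.

Lemma nilpotent_killed (M : lmodType R) (s : seq R) (K : set M) :
  submod K -> (forall a, a \in s -> exists n, forall x, K x -> a ^+ n *: x = 0) ->
  (exists2 A, T A & K `&` ann (fun a => a \in s) `<=` ann A) ->
  exists2 A, T A & K `<=` ann A.
Proof.
move=> sK nilK Ks; apply/(Sin_killed sK).
apply: (Sin_nilpotent_seq serre_killed (s := s)) => //.
by apply/Sin_killed => //; apply: submodI => //; apply: submod_ann.
Qed.

End Killed.

(** Applying [nilpotent_killed] to the cyclic module [R x], with sets of n-fold products from [I],
    replaces a pigeonhole count of exponents. *)
Lemma Gamma_generates (R : comNzRingType) (M : lmodType R) (I : {pred R})
    (s : seq R) (x : M) : generates s (mem_set_of I) ->
  (forall a, a \in s -> exists n, a ^+ n *: x = 0) -> Gamma I M x.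
Proof.
move=> sI tors.
pose pw n : set R := [set b | exists2 f : 'I_n -> R, (forall j, f j \in I) & b = \prod_j f j].
have sK : submod (range (fun b : R => b *: x)).
  split; first by exists 0; rewrite ?scale0r.
  by move=> a _ _ [b _ <-] [c _ <-]; exists (a * b + c); rewrite // scalerDl scalerA.
have [||||_ [n n0 <-] xn] :=
  @nilpotent_killed R [set pw n | n in [set n | (0 < n)%N]] _ _ M s _ sK.
- by exists (pw 1%N), 1%N.
- move=> _ _ [i i0 <-] [j j0 <-]; exists (pw (i + j)%N).
    by exists (i + j)%N; rewrite /= ?addn_gt0 ?i0.
  move=> _ [f fI ->]; rewrite big_split_ord /=.
  exists (\prod_k f (lshift j k)); first by exists (fun k => f (lshift j k)).
  by exists (\prod_k f (rshift i k)) => //; exists (fun k => f (rshift i k)).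
- move=> a /tors[n an]; exists n => _ [b _ <-].
  by rewrite scalerA mulrC -scalerA an scaler0.
- exists (pw 1%N); first by exists 1%N.
  move=> y [_ /(ann_generates sI) Iy] _ [f fI ->].
  by apply: Iy; rewrite big_ord1; apply: fI.
exists n => // _ [k [c [b [bI ->]]]].
rewrite scaler_suml big1 // => i _; rewrite -scalerA.
have -> : (\prod_j b i j) *: x = 0; last by rewrite scaler0.
apply: (xn x); first by exists 1; rewrite ?scale1r.
by exists (b i).
Qed.

(** * Quotient modules *)

Section QuotientModules.
Variables (R : comNzRingType) (V : lmodType R) (U : set V) (sU : submod U).

(** The additive quotient group; the scalar action is added below through representatives. *)
Definition quot_mod : Type := Quotient.quot (sub_pred sU).

HB.instance Definition _ := GRing.Zmodule.on quot_mod.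

Definition quot_pi (v : V) : quot_mod := (\pi_(Quotient.quot (sub_pred sU)) v)%qT.
Definition quot_scale (a : R) (x : quot_mod) : quot_mod := quot_pi (a *: repr x).

Lemma quot_piE v w : quot_pi v = quot_pi w <-> U (v - w).
Proof.
split=> [/eqP|Uvw]; first by rewrite -Quotient.idealrBE => /asboolP.
by apply/eqP; rewrite -Quotient.idealrBE; apply/asboolP.
Qed.

Lemma quot_piK x : quot_pi (repr x) = x.
Proof. exact: reprK. Qed.

Lemma quot_piD v w : quot_pi (v + w) = quot_pi v + quot_pi w.
Proof. by rewrite /quot_pi !piE. Qed.

Lemma quot_piZ a v : quot_pi (a *: v) = quot_scale a (quot_pi v).
Proof.
apply/quot_piE; rewrite -scalerBr; apply: submodZ => //.
by apply/quot_piE; rewrite quot_piK.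
Qed.

Lemma quot_scaleA a b x : quot_scale a (quot_scale b x) = quot_scale (a * b) x.
Proof. by rewrite -[x]quot_piK -!quot_piZ scalerA. Qed.

Lemma quot_scale1 : left_id 1 quot_scale.
Proof. by move=> x; rewrite -[x]quot_piK -!quot_piZ scale1r. Qed.

Lemma quot_scaleDr : right_distributive quot_scale +%R.
Proof.
move=> a x y; rewrite -[x]quot_piK -[y]quot_piK -quot_piD -!quot_piZ.
by rewrite scalerDr quot_piD.
Qed.

Lemma quot_scaleDl x : {morph quot_scale^~ x : a b / a + b}.
Proof. by move=> a b; rewrite -[x]quot_piK -!quot_piZ scalerDl quot_piD. Qed.

HB.instance Definition _ := GRing.Zmodule_isLmodule.Build R quot_mod
  quot_scaleA quot_scale1 quot_scaleDr quot_scaleDl.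

Lemma quot_pi_linear : linear quot_pi.
Proof. by move=> a v w; rewrite quot_piD quot_piZ. Qed.

HB.instance Definition _ := GRing.isLinear.Build R V quot_mod *:%R quot_pi quot_pi_linear.

Lemma quot_mod_exists : exists (N : lmodType R) (g : {linear V -> N}),
  range g = setT /\ forall v, g v = 0 <-> U v.
Proof.
exists quot_mod, quot_pi; split=> [|v].
  by apply/seteqP; split=> // x _; exists (repr x) => //; apply: quot_piK.
by rewrite -[in X in X <-> _](linear0 quot_pi) quot_piE subr0.
Qed.

End QuotientModules.

(** * The module D[1/s]/D and Krull's intersection theorem *)

Section FractionQuotient.
Variables (R : comNzRingType) (P : {pred R}) (s : R).
Hypotheses (SP : Spec P) (sP : s \notin P).

Let subP := idealr_submod SP.1.

Lemma primeX n : s ^+ n \notin P.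
Proof.
elim: n => [|n IH]; first by rewrite expr0; case: SP => -[].
apply/negP; rewrite exprS => /SP.2; rewrite (negbTE sP) /=.
exact/negP.
Qed.

Lemma prime_cancel n c : s ^+ n * c \in P -> c \in P.
Proof. by move=> /SP.2; rewrite (negbTE (primeX n)). Qed.

(* [s^n f(1/s)], for [f] of degree at most [n]. *)
Definition clear_denom n (f : {poly R}) : R := \sum_(i < n.+1) f`_i * s ^+ (n - i).

Lemma clear_denomP n a (f g : {poly R}) :
  clear_denom n (a *: f + g) = a * clear_denom n f + clear_denom n g.
Proof.
rewrite /clear_denom mulr_sumr -big_split /=; apply: eq_bigr => i _.
by rewrite coefD coefZ mulrDl mulrA.
Qed.

Lemma clear_denomXn n c : clear_denom n (c *: 'X^n) = c.
Proof.
rewrite /clear_denom big_ord_recr /= subnn expr0 mulr1 coefZ coefXn eqxx mulr1.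
rewrite big1 ?add0r // => i _.
by rewrite coefZ coefXn (ltn_eqF (ltn_ord i)) mulr0 mul0r.
Qed.

Lemma clear_denomS n (f : {poly R}) : (size f <= n.+1)%N ->
  clear_denom n.+1 f = s * clear_denom n f.
Proof.
move=> sf; rewrite /clear_denom big_ord_recr /= nth_default // mul0r addr0.
rewrite mulr_sumr; apply: eq_bigr => i _.
by rewrite subSn -1?ltnS // exprS mulrCA.
Qed.

Lemma clear_denomD n k (f : {poly R}) : (size f <= n.+1)%N ->
  clear_denom (n + k) f = s ^+ k * clear_denom n f.
Proof.
move=> sf; elim: k => [|k IH]; first by rewrite addn0 expr0 mul1r.
rewrite addnS clear_denomS; first by rewrite IH mulrA exprS.
by apply: leq_trans sf _; rewrite ltnS leq_addr.
Qed.

(** The polynomials [f] of degree at most [n] whose value [f(1/s)] in D[1/s] lies in D = R/P. *)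
Definition integral_at n : set {poly R} :=
  [set f : {poly R} | (size f <= n.+1)%N /\ exists r, clear_denom n f - s ^+ n * r \in P].

Lemma integral_at_leq n k : (n <= k)%N -> integral_at n `<=` integral_at k.
Proof.
move=> nk f [sf [r hr]]; split; first exact: leq_trans sf _.
exists r; rewrite -(subnKC nk) clear_denomD // exprD [_ * s ^+ (k - n)]mulrC.
by rewrite -mulrA -mulrBr; apply: (submodZ _ subP).
Qed.

Lemma submod_integral : submod (\bigcup_n integral_at n).
Proof.
apply: submod_bigcup => n; last exact: integral_at_leq.
split=> [|a f g [sf [r hr]] [sg [t ht]]].
  split; first by rewrite size_poly0.
  exists 0; rewrite mulr0 subr0 /clear_denom big1; first exact: (submod0 subP).
  by move=> i _; rewrite coef0 mul0r.
split.
  rewrite (leq_trans (size_polyD _ _)) // geq_max sg andbT.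
  exact: leq_trans (size_scale_leq _ _) sf.
exists (a * r + t); rewrite clear_denomP mulrDr opprD addrACA mulrCA -mulrBr.
exact: (subP.2 a _ _ hr ht).
Qed.

(* The module D[1/s]/D for D = R/P, generated by the classes e n of s^-n. *)
Lemma fraction_quotient : exists (N : lmodType R) (e : nat -> N),
  [/\ forall y, exists c n, y = c *: e n,
      forall n, s *: e n.+1 = e n &
      forall c n, c *: e n = 0 <-> exists r, c - s ^+ n * r \in P].
Proof.
(* The module is a quotient of [{poly R}], with ['X] standing for [1/s]. *)
have [N [g [gT g0]]] := quot_mod_exists submod_integral.
have P0 : 0 \in P by exact: (submod0 subP).
have size_cX c n : (size (c *: 'X^n : {poly R}) <= n.+1)%N.
  by apply: leq_trans (size_scale_leq _ _) _; rewrite size_polyXn.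
exists N, (fun n => g 'X^n); split=> [y|n|c n].
- have : range g y by rewrite gT.
  (* [f] and [clear_denom n f *: 'X^n] have the same value at [1/s], so their difference is integral
     with [r = 0]. *)
  move=> [f _ <-]; set n := size f; exists (clear_denom n f), n.
  rewrite -linearZ /=; apply/eqP; rewrite -subr_eq0 -linearB; apply/eqP/g0.
  exists n => //; split.
    by rewrite (leq_trans (size_polyD _ _)) // geq_max size_polyN size_cX leqnSn.
  exists 0; rewrite mulr0 subr0 addrC -scaleN1r clear_denomP clear_denomXn.
  by rewrite mulN1r addNr.
- rewrite -linearZ /=; apply/eqP; rewrite -subr_eq0 -linearB; apply/eqP/g0.
  exists n.+1 => //; split.
    rewrite (leq_trans (size_polyD _ _)) // geq_max size_polyN size_cX.
    by rewrite size_polyXn leqnSn.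
  exists 0; rewrite mulr0 subr0 addrC -scaleN1r clear_denomP clear_denomXn.
  rewrite clear_denomS ?size_polyXn // -['X^n]scale1r clear_denomXn.
  by rewrite mulr1 mulN1r addNr.
- rewrite -linearZ /= g0; split=> [[k _ fk]|[r hr]]; last first.
    by exists n => //; split=> //; exists r; rewrite clear_denomXn.
  have [_ [r]] := integral_at_leq (leq_addl n k) fk.
  rewrite clear_denomD // clear_denomXn addnC exprD -mulrA -mulrBr => hr.
  by exists r; apply: prime_cancel hr.
Qed.

End FractionQuotient.

(** Write [t = s^n r_n] modulo [P]; then [r_n = s r_(n+1)], so the ideals [P + (r_n)] ascend. Once
    they stabilize, [r_(n+1) = u r_n = u s r_(n+1)] modulo [P]. As [s] is in [m], the factor
    [1 - u s] is outside [P], which forces [r_(n+1)] and [t] into [P]. *)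
Lemma krull_intersection (R : comNzRingType) (P m : {pred R}) (s t : R) :
  noetherian R -> Spec P -> idealr_closed m -> {subset P <= m} ->
  s \in m -> s \notin P ->
  (forall n, exists r, t - s ^+ n * r \in P) -> t \in P.
Proof.
move=> noeth SP im Pm sm sP /choice[r hr].
have subP := idealr_submod SP.1.
have step n : r n - s * r n.+1 \in P.
  apply: (prime_cancel SP sP (n := n)).
  have -> : s ^+ n * (r n - s * r n.+1) = (t - s ^+ n.+1 * r n.+1) - (t - s ^+ n * r n).
    by rewrite opprB [RHS]addrC addrA subrK mulrBr mulrA -exprSr.
  exact: (submodB subP (hr _) (hr _)).
pose F n : set R^o := [set x | exists u, x - u * r n \in P].
have sF n : submod (F n).
  split=> [|a x y [u hu] [v hv]].
    by exists 0; rewrite mul0r subr0; apply: (submod0 subP).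
  exists (a * u + v); rewrite mulrDl opprD addrACA -mulrA -mulrBr.
  exact: (subP.2 a _ _ hu hv).
have incF n : F n `<=` F n.+1.
  move=> x [u hu]; exists (u * s).
  have -> : x - u * s * r n.+1 = u * (r n - s * r n.+1) + (x - u * r n).
    by rewrite mulrBr mulrA [RHS]addrC addrA subrK.
  exact: (subP.2 _ _ _ (step n) hu).
have [n Fn] := noetherian_acc noeth sF incF.
have [|u hu] := Fn (r n.+1).
  by exists 1; rewrite mul1r subrr; apply: (submod0 subP).
have : (1 - u * s) * r n.+1 \in P.
  have -> : (1 - u * s) * r n.+1 = u * (r n - s * r n.+1) + (r n.+1 - u * r n).
    by rewrite mulrBl mul1r mulrBr mulrA [RHS]addrC addrA subrK.
  exact: (subP.2 _ _ _ (step n) hu).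
move=> /SP.2 /orP[/Pm us|rP].
  case: im => _ /negP m1 hm; case: m1.
  suff : u * s + (1 - u * s) \in m by rewrite addrC subrK.
  exact: hm.
rewrite -(subrK (s ^+ n.+1 * r n.+1) t).
exact: (submodD subP (hr _) (submodZ _ subP rP)).
Qed.

(** * The Serre subcategory attached to a prime P *)

Section ArtinianAway.
Variables (R : comNzRingType) (P : {pred R}).
Hypotheses (noeth : noetherian R) (SP : Spec P).

Let non_P : set (set R) := [set [set s] | s in [set s | s \notin P]].

Let non_P0 : exists A, non_P A.
Proof. by exists [set 1], 1 => //=; case: SP => -[]. Qed.

Let non_PM A B : non_P A -> non_P B ->
  exists2 C, non_P C & C `<=` [set a * b | a in A & b in B].
Proof.
move=> [s sP <-] [t tP <-]; exists [set s * t]; last first.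
  by move=> _ ->; exists s => //; exists t.
exists (s * t) => //=; apply/negP => /SP.2.
by rewrite (negbTE sP) (negbTE tP).
Qed.

Definition artinian_away (M : lmodType R) : Prop :=
  artinian [set: M] /\
  exists2 s, s \notin P & forall x : M, ann (mem_set_of P) x -> s *: x = 0.

(* Dual of the Artin-Rees lemma. A minimal [W] with [W + K = L] is P-torsion,
   because [a^n W = a^(2n) W] gives [L = (0 :_W a^n) + K] for [a] in P. *)
Lemma artin_rees_dual (M : lmodType R) (K L : set M) :
  artinian [set: M] -> submod K -> submod L ->
  (forall a, a \in P -> scaled a L `<=` K) ->
  exists W, [/\ submod W, W `<=` L, L `<=` sumset W K &
    forall a, a \in P -> exists n, forall x, W x -> a ^+ n *: x = 0].
Proof.
move=> aM sK sL PLK.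
pose Q (W : set M) := [/\ submod W, W `<=` L & L `<=` sumset W K].
have [|W []//|W [[sW WL LW] minW]] := artinian_minimal (Q := Q) aM.
  by exists L; split=> //; apply: sub_sumsetl.
exists W; split=> // a aP.
have [n|//|n|n hn] := aM (fun n => scaled (a ^+ n) W).
- exact: submod_scaled.
- move=> _ [x Wx <-]; rewrite exprSr -scalerA; exists (a *: x) => //.
  exact: submodZ.
(* The exponent [n.+1] guarantees a factor [a], so that [a^(n+1) W] lies in [aL] and hence in
   [K]. *)
exists n.+1; pose A := [set x : M | a ^+ n.+1 *: x = 0].
have sA : submod A by apply: submod_scaler_ker.
suff WA : W `<=` W `&` A by move=> x /WA[].
apply: minW; last by move=> x [].
split; [exact: submodI|by move=> x [/WL]|move=> y /LW[w [z [Ww Kz ->]]]].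
have nn : (n <= n.+1 + n.+1)%N by rewrite addSn leqW // leq_addr.
have [|x Wx wx] := hn _ nn (a ^+ n.+1 *: w).
  by exists (a *: w); [apply: submodZ|rewrite scalerA -exprSr].
exists (w - a ^+ n.+1 *: x), (a ^+ n.+1 *: x + z); split.
- split; first by apply: submodB => //; apply: submodZ.
  by rewrite /A /= scalerBr scalerA -exprD wx subrr.
- apply: submodD => //; rewrite exprS -scalerA; apply: (PLK a aP).
  by exists (a ^+ n *: x) => //; apply: WL; apply: submodZ.
- by rewrite addrA subrK.
Qed.

Lemma serre_artinian_away : serre_subcategory artinian_away.
Proof.
split=> [|L M f fI [aM [s sP hs]]|M N g gT [aM [s sP hs]]
        |L M N f g fI fg gT [aL [s sP hs]] [aN [t tP ht]]].
- exists 'rV[R]_0; split; last first.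
    by exists 1 => [|x _]; [case: SP => -[]|apply/rowP => -[]].
  move=> F sF _ _; exists 0%N => k _ x _.
  have -> : x = 0 by apply/rowP => -[].
  exact: submod0.
- split; first by rewrite -(preimage_setT f); apply: artinian_pull.
  exists s => // x Px; apply: fI; rewrite linearZ linear0 /=; apply: hs.
  by move=> a aP; rewrite -linearZ /= Px // linear0.
- split; first by rewrite -gT; apply: artinian_range.
  have sK := submod_ker g.
  (* [L] is the preimage of the part of [N] killed by [P]. The submodule [W] maps onto that part,
     and being P-torsion it is killed by a single [t] outside [P]. *)
  have sL := submod_preimage g (submod_ann N (mem_set_of P)).
  have [|W [sW WL LW PW]] := artin_rees_dual aM sK sL.
    by move=> a aP _ [x Lx <-]; rewrite /= linearZ /= Lx.
  have [l [lP lgen]] := noetherian_generates noeth (idealr_submod SP.1).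
  have [||_ [t tP <-] Wt] := nilpotent_killed non_P0 non_PM sW (s := l).
  + by move=> a /lP; apply: PW.
  + exists [set s]; first by exists s.
    by move=> x [_ lx] _ ->; apply: hs; apply: ann_generates lx.
  exists t => // y Py; have : range g y by rewrite gT.
  move=> [x _ gx]; have /LW[w [z [Ww Kz xE]]] : (g @^-1` ann (mem_set_of P)) x.
    by rewrite /preimage /= gx.
  by rewrite -gx xE linearD Kz addr0 -linearZ /= (Wt _ Ww t) // linear0.
- split.
    apply: (artinian_ext (h := g)); last by rewrite gT.
    by rewrite setTI -fg; apply: artinian_range.
  exists (s * t) => [|x Px]; first by apply/negP => /SP.2; rewrite (negbTE sP) (negbTE tP).
  (* [t x] comes from an element of [L] killed by [P], which [s] then kills. *)
  have : range f (t *: x).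
    rewrite fg /= linearZ /=; apply: ht => a aP.
    by rewrite -linearZ /= Px // linear0.
  move=> [y _ fy]; rewrite -scalerA -fy -linearZ /= hs ?linear0 // => a aP.
  apply: fI; rewrite linearZ /= fy linear0 scalerA mulrC -scalerA.
  by rewrite Px // scaler0.
Qed.

(** Being artinian lifts by Melkersson's criterion. Since [p] is contained in [P], all that [P]
    kills in [M] lies in the part killed by [p], so the same [s] works. *)
Lemma artinian_away_melkersson (p : {pred R}) : idealr_closed p ->
  {subset p <= P} -> melkersson artinian_away p.
Proof.
move=> ip pP M tors [aM [s sP hs]]; split.
  have [l [lp lgen]] := noetherian_generates noeth (idealr_submod ip).
  apply: (artinian_torsion_seq (s := l)) => // [a x /lp ap _|].
    by apply: (Gamma_pow (I := p)) ap; rewrite tors.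
  rewrite setTI; apply: artinian_sub (_ : _ `<=` range (val : {linear ann_mod p M -> M})) _.
    by rewrite range_ann_mod; apply: ann_generates.
  exact: artinian_range.
exists s => // x Px.
have : range (val : {linear ann_mod p M -> M}) x.
  by rewrite range_ann_mod => a ap; apply: Px; apply: pP.
move=> [y _ yx].
have sy : s *: y = 0.
  by apply: hs => a aP; apply: val_inj; rewrite linear0 linearZ -(Px a aP) -yx.
by rewrite -yx; transitivity (val (s *: y)); [rewrite linearZ|rewrite sy linear0].
Qed.

Lemma artinian_away_not_melkersson (m : {pred R}) : maximal_ideal m ->
  {subset P <= m} -> P <> m ->
  (forall Q, Spec Q -> {subset P <= Q} -> Q = P \/ Q = m) ->
  ~ melkersson artinian_away m.
Proof.
move=> mm Pm nPm dim1 C.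
have [s sm sP] := neq_pred_sub Pm nPm.
have subP := idealr_submod SP.1; have im := mm.1.
have [N [e [gen se ker]]] := fraction_quotient SP sP.
have Pe a n : a \in P -> a *: e n = 0.
  by move=> aP; apply/ker; exists 0; rewrite mulr0 subr0.
have sXe i n : s ^+ i *: e (i + n)%N = e n.
  elim: i n => [|i IH] n; first by rewrite expr0 scale1r.
  by rewrite exprSr -scalerA addSn se.
have [l [lm lgen]] := noetherian_generates noeth (idealr_submod im).
have torsN : Gamma m N = setT.
  apply/seteqP; split=> // y _; have [c [n ->]] := gen y.
  apply: (Gamma_generates (s := l)); first by split.
  move=> a /lm am.
  have ssN : submod (range (fun r : R^o => s ^+ n * r : R^o)).
    split; first by exists 0; rewrite ?mulr0.
    move=> b _ _ [u _ <-] [v _ <-]; exists (b * u + v) => //.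
    by rewrite mulrDr mulrCA.
  (* Only [m] lies over [P + (s^n)], so a power of [a] lies in that ideal, which kills [e n]. *)
  have [Q SQ JQ|k [u [_ [uP [r _ <-] aE]]]] :=
      radical_prime noeth (x := a) (submod_sumset subP ssN).
    have PQ : {subset P <= Q} by move=> x xP; apply: JQ; apply: sub_sumsetl.
    have sQ : s ^+ n \in Q.
      by apply: JQ; apply: sub_sumsetr => //; exists 1; rewrite ?mulr1.
    have [QP|->//] := dim1 Q SQ PQ.
    by have := primeX SP sP n; rewrite -QP sQ.
  exists k; rewrite scalerA mulrC -scalerA aE scalerDl Pe // add0r.
  have -> : (s ^+ n * r) *: e n = 0; last by rewrite scaler0.
  by apply/ker; exists r; rewrite subrr; apply: (submod0 subP).
(* If [s c] kills [e n.+1], then [c] is a multiple of [s^n] modulo [P], and [c *: e n.+1] is a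
   multiple of [e 1]. *)
have annE (y : N) : ann (mem_set_of m) y -> exists r : R, y = r *: e 1%N.
  have [c [[|n] ->]] := gen y => my.
    exists 0; rewrite scale0r; apply/ker; exists c.
    by rewrite expr0 mul1r subrr; apply: (submod0 subP).
  have /ker[r hr] : (s * c) *: e n.+1 = 0 by rewrite -scalerA; apply: my.
  exists r; have cP : c - s ^+ n * r \in P.
    by apply: (prime_cancel SP sP (n := 1)); rewrite expr1 mulrBr mulrA -exprS.
  rewrite -(subrK (s ^+ n * r) c) scalerDl (Pe _ _ cP) add0r.
  by rewrite mulrC -scalerA -addn1 sXe.
(* The socle corresponds to this ideal of multipliers of [e 1]; finite generation of the ideal makes
   the socle finite-dimensional. *)
have sJ : submod [set r : R^o | ann (mem_set_of m) (r *: e 1%N)].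
  split=> [|b u v Ju Jv]; first by rewrite /= scale0r; apply: (submod0 (submod_ann _ _)).
  by rewrite /= scalerDl -scalerA; apply: (submod_ann N (mem_set_of m)).2.
have [g [gJ ggen]] := noetherian_generates noeth sJ.
pose v := [seq (r : R) *: e 1%N | r <- g].
have mv a x : a \in m -> x \in v -> a *: x = 0.
  by move=> am /mapP[r /gJ Jr ->]; apply: Jr.
have annv : (ann (mem_set_of m) : set N) `<=` lin_span v.
  move=> y my; have [r yE] := annE y my; rewrite yE.
  have sv : submod [set r : R^o | lin_span v ((r : R) *: e 1%N)].
    split=> [|b x z hx hz]; first by rewrite /= scale0r; apply: (submod0 (submod_lin_span _)).
    by rewrite /= scalerDl -scalerA; apply: (submod_lin_span v).2.
  apply: (ggen _ sv); last by rewrite /= -yE.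
  move=> u ug /=; have : u *: e 1%N \in v by apply: map_f.
  elim: (v) => [//|x w IH]; rewrite inE => /predU1P[->|/IH hw].
    by exists 1, 0; rewrite scale1r addr0; split=> //; apply: (submod0 (submod_lin_span _)).
  by exists 0, (u *: e 1%N); rewrite scale0r add0r.
have [_ [t tP ht]] : artinian_away N.
  apply: C => //; split.
    have aA : artinian (ann (mem_set_of m) : set N).
      by apply: artinian_sub annv _; apply: artinian_lin_span mv.
    apply: artinian_sub (artinian_pull (f := (val : {linear ann_mod m N -> N})) _ aA).
      by move=> x _; apply/asboolP/(valP x).
    exact: val_inj.
  exists s => // x _; apply: val_inj; rewrite linear0 linearZ.
  by have /asboolP mx := valP x; apply: mx.
(* [P] kills each [e n], so [t] does too; hence [t] lies in [s^n D] for every [n]. *)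
case/negP: tP; apply: (krull_intersection noeth SP im Pm sm sP) => n.
by apply/ker; apply: ht => a aP; apply: Pe.
Qed.

End ArtinianAway.

(** * Excluding chains of four primes *)

Lemma dim_le2_of_locus_forms (R : comNzRingType) (q : {pred R}) :
  noetherian R -> local_ring R -> unique_minimal_prime q ->
  (forall S : lmodType R -> Prop, serre_subcategory S ->
      locus_form_a q S \/ locus_form_b q S) ->
  krull_dim_le R 2.
Proof.
move=> noeth loc uq forms k c [Sc inc]; rewrite leqNgt; apply/negP => k2.
have [m [mm _]] := loc.
have [Sm pm] := local_max noeth loc mm.
pose o i (ik : (i < k.+1)%N) := c (Ordinal ik).
have l0 : (0 < k.+1)%N by [].
have l1 : (1 < k.+1)%N by apply: leq_trans (ltnW k2) _.
have l2 : (2 < k.+1)%N by apply: leq_trans k2 _.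
have l3 : (3 < k.+1)%N by [].
have h01 : ssub (o 0%N l0) (o 1%N l1) by apply: inc.
have h12 : ssub (o 1%N l1) (o 2%N l2) by apply: inc.
have h23 : ssub (o 2%N l2) (o 3%N l3) by apply: inc.
have nq p p' : Spec p -> ssub p p' -> p' <> q.
  move=> Sp [pp' np'] p'q; case: uq => -[_ minq] _; apply: np'.
  by rewrite p'q -(minq _ Sp) // -p'q.
(* [P] is maximal among the primes other than [m] that contain the third prime of the chain, which
   makes R/P one-dimensional. *)
have [|J [P [SP JE c2P nPm]] //|J [[P [SP JE c2P nPm]] maxP]] := noetherian_maximal noeth
    (Q := fun J => exists P, [/\ Spec P, J = mem_set_of P, {subset o 2%N l2 <= P} & P <> m]).
- exists (mem_set_of (o 2%N l2)), (o 2%N l2); split=> //; first exact: Sc.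
  by move=> c2m; case: h23 => _ []; rewrite c2m => x; apply: pm; apply: Sc.
- by rewrite JE; apply: idealr_submod; case: SP.
have dim1 Q : Spec Q -> {subset P <= Q} -> Q = P \/ Q = m.
  move=> SQ PQ; have [->|nQm] := pselect (Q = m); [by right|left].
  apply: eq_predP => // x Qx; rewrite JE in maxP; apply: (maxP (mem_set_of Q)) => //.
  by exists Q; split=> // y /c2P /PQ.
have Cc p : Spec p -> {subset p <= P} -> melkersson_locus (artinian_away P) p.
  by move=> Sp pP; split=> //; apply: artinian_away_melkersson => //; case: Sp.
have C1 := Cc _ (Sc (Ordinal l1)) (fun x h => c2P x (h12.1 x h)).
have C2 := Cc _ (Sc (Ordinal l2)) c2P.
have nCm : ~ melkersson_locus (artinian_away P) m.
  by move=> [_]; apply: artinian_away_not_melkersson => //; apply: pm.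
have n1 := nq _ _ (Sc (Ordinal l0)) h01.
have n2 := nq _ _ (Sc (Ordinal l1)) h12.
(* Form (a) would carry membership from the second prime of the chain up to [m]; form (b) would
   identify the second and third primes. *)
have [[W [[_ spW] ME]]|[p [_ _ ME]]] := forms _ (serre_artinian_away noeth SP).
  move: C1; rewrite ME => -[/n1 //|W1]; apply: nCm; rewrite ME; right.
  by apply: spW W1 Sm _; apply: pm; apply: Sc.
move: C1 C2; rewrite ME => -[/n1 //|c1p] [/n2 //|c2p].
by case: h12 => _ []; rewrite /o c1p c2p.
Qed.

Theorem theorem6p4 (R : comNzRingType) (q : {pred R}) :
  noetherian R -> local_ring R -> unique_minimal_prime q ->
  (krull_dim_eq R 2 ->
     forall S : lmodType R -> Prop, serre_subcategory S ->
       locus_form_a q S \/ locus_form_b q S)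
  /\
  ((forall S : lmodType R -> Prop, serre_subcategory S ->
      locus_form_a q S \/ locus_form_b q S) ->
     krull_dim_le R 2).
Proof.
move=> noeth loc uq; split=> [[_ d2] S serreS|]; first exact: locus_dim_le2.
exact: dim_le2_of_locus_forms.
Qed.
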